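(* Let $c,d\in\mathbb R^2$, let $0<\rho<\rho'$ and $0<\tau<\tau'$ be real numbers, and let $S=S(c,\rho)\cup S(c,\rho')$ and $R=S(d,\tau)\cup S(d,\tau')$. Suppose that $f\colon S\to R$ is a collinearity isomorphism. Then $f$ is a betweenness isomorphism.
   Context: For $c\in\mathbb R^2$ and $\rho\in(0,\infty)$, $S(c,\rho)$ denotes the circle (curve) in the Euclidean plane with center $c$ and radius $\rho$. For $u,v\in\mathbb R^2$, $[u,v]=\{\lambda u+(1-\lambda)v:\lambda\in[0,1]\}$. For $A,B\subseteq\mathbb R^2$: a betweenness isomorphism from $A$ to $B$ is a bijection $f\colon A\to B$ such that for all $x,y,z\in A$: $f(x)\in[f(y),f(z)]$ if and only if $x\in[y,z]$; a collinearity isomorphism from $A$ to $B$ is a bijection $f\colon A\to B$ such that for all $x,y,z\in A$: the points $f(x),f(y),f(z)$ are collinear if and only if $x,y,z$ are collinear. *)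

(* Defs.v *)
From mathcomp Require Import all_boot all_order all_algebra.
From mathcomp Require Import classical_sets functions reals.

Set Implicit Arguments.
Unset Strict Implicit.
Unset Printing Implicit Defensive.

Import Order.TTheory GRing.Theory Num.Theory.

Local Open Scope ring_scope.
Local Open Scope classical_set_scope.

Section Plane.
Variable R : realType.

Local Notation plane := 'rV[R]_2.

(* The norm `|_| of MathComp-Analysis on 'rV[R]_2 is the sup norm, hence this
   definition. *)
Definition euclid_norm (u : plane) : R := Num.sqrt (\sum_(i < 2) u 0 i ^+ 2).

Definition circle (c : plane) (r : R) : set plane :=
  [set p | euclid_norm (p - c) = r].

Definition segment (u v : plane) : set plane :=
  [set p | exists l : R, 0 <= l <= 1 /\ p = l *: u + (1 - l) *: v].

Definition line (p v : plane) : set plane :=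
  [set q | exists t : R, q = p + t *: v].

(* The points x, y, z need not be distinct. *)
Definition collinear (x y z : plane) : Prop :=
  exists p v : plane, v != 0 /\ [/\ line p v x, line p v y & line p v z].

(* A map between subsets A and B of the plane is represented by a total
   function; only its values on A are used. *)
Definition betweenness_iso (A B : set plane) (f : plane -> plane) : Prop :=
  set_bij A B f /\
  forall x y z, A x -> A y -> A z ->
    (segment (f y) (f z) (f x) <-> segment y z x).

Definition collinearity_iso (A B : set plane) (f : plane -> plane) : Prop :=
  set_bij A B f /\
  forall x y z, A x -> A y -> A z ->
    (collinear (f x) (f y) (f z) <-> collinear x y z).

End Plane.

(* Main.v *)
Require Import Defs.
From mathcomp Require Import all_boot all_order all_algebra.
From mathcomp Require Import classical_sets functions reals.
From mathcomp Require Import boolp ring lra.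

Import Order.TTheory GRing.Theory Num.Theory.

Local Open Scope ring_scope.
Local Open Scope classical_set_scope.

(** Place both centres at 0, with radii r < s, and call points inner or outer
    according to their circle.

    Collinearity recognizes the inner points: every line through an inner point
    and another point of the configuration contains a third one, while an outer
    point can be joined to a nearby outer point by a line that misses the inner
    circle ([third_pointsP]). It also recognizes the pairs of outer points that
    are far, meaning that their line meets the inner circle
    ([line_meets_inner]), and the outer points p on the tangent at an inner
    point b ([tangentP]). Strictly between two other points lie only inner
    points, and the only betweenness that is not forced by these notions is
    this one: on a line with two inner points b, b' and an outer point x, which
    of b, b' is nearer to x ([segmentP]). The point b is the nearer one exactly
    when the tangent at b separates x from the centre, and [near] expresses
    this as r^2 < <x, b>. So the task is to show that [near] is preserved.

    The tangent at b cuts the outer circle at p and q into a minor arc M, the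
    points near b, and a major arc. Points of M are far neither from p nor
    from q, a property that an isomorphism preserves ([clear]). Let A be the set
    of clear points of the major arc; it is nonempty once s > 2 r. Two points of
    M are never far from each other ([near_not_far]), and an outer point far
    from a point of A is in M ([clear_far_near]). Hence along any edge of the
    far relation between clear points the arcs M and A alternate.

    Suppose now that x is near b but f x is not near f b. Follow the tangents
    to the inner circle: let x_0 = x, and let x_(n+1) be the image of x_n under
    the rotation that takes an outer point to the other end of its tangent
    chord. Alternation on both sides, with clearness carried across f and its
    inverse, keeps x_n in the arc M of b for n even and in A for n odd, with
    the roles of the two arcs exchanged for the images f x_n ([iso_near]). But a
    point cannot stay in an open half-plane missing the centre under all
    iterates of a rotation by an angle that is not a multiple of 2 pi
    ([orbit_leaves_near]). *)

(** * Inequalities for arcs cut by a vertical chord *)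

(** In this part the circle has squared radius K^2 + H^2 and the chord joins
    p = (K, H) to q = (K, -H), so that <p, q> = K^2 - H^2: two points of the
    circle are closer together than p and q when their product exceeds this
    number. A point left of the chord and closer to p and to q than these are
    to each other has its antipode on the closed minor arc. *)
Lemma cap_beyond_chord {R : realFieldType} {K H u v : R} :
  0 < K -> 0 < H -> u ^+ 2 + v ^+ 2 = K ^+ 2 + H ^+ 2 -> u <= K ->
  K ^+ 2 - H ^+ 2 < u * K + v * H -> K ^+ 2 - H ^+ 2 < u * K - v * H ->
  u <= - K.
Proof.
move=> K0 H0 e uK h1 h2; rewrite leNgt; apply/negP => Ku.
have uuKK : 0 <= (K - u) * (u + K) by rewrite mulr_ge0; lra.
have [v0|v0] := lerP 0 v.
  have : H <= v by rewrite -(ler_pXn2r (_ : 0 < 2)%N) ?nnegrE ?(ltW H0) //; nra.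
  nra.
have : H <= - v.
  rewrite -(ler_pXn2r (_ : 0 < 2)%N) ?nnegrE ?(ltW H0) ?oppr_ge0 ?(ltW v0) //.
  nra.
nra.
Qed.

(** Let y = (u', v') be as in the previous lemma. The product with y is minimal
    at -y, which lies on the open minor arc or at an end of it, so on the major
    arc the minimum is attained at p or q, where it exceeds <p, q>. *)
Lemma major_arc_close {R : realFieldType} {K H u v u' v' : R} :
  0 < K -> 0 < H -> u ^+ 2 + v ^+ 2 = K ^+ 2 + H ^+ 2 ->
  u' ^+ 2 + v' ^+ 2 = K ^+ 2 + H ^+ 2 -> u <= K -> u' <= K ->
  K ^+ 2 - H ^+ 2 < u' * K + v' * H -> K ^+ 2 - H ^+ 2 < u' * K - v' * H ->
  K ^+ 2 - H ^+ 2 < u * u' + v * v'.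
Proof.
move=> K0 H0.
wlog v'0 : v v' / 0 <= v' => [wl|].
  have [|v'0] := lerP 0 v'; first exact: wl.
  move=> e e' uK u'K h1 h2.
  rewrite -(mulrNN v v'); apply: wl; rewrite ?sqrrN //; lra.
move=> e e' uK u'K h1 h2.
have u'_le := cap_beyond_chord K0 H0 e' u'K h1 h2.
(* As v' >= 0, the smaller of the products of y with p and q is the one with
   q; it remains to compare it with the product of y and (u, v). *)
suff : 0 <= (K - u) * (- u') + (v + H) * v' by lra.
have v'H : v' <= H.
  by rewrite -(ler_pXn2r (_ : 0 < 2)%N) ?nnegrE ?(ltW H0) //; nra.
have [vH|vH] := lerP (- H) v.
  by rewrite addr_ge0 // mulr_ge0 //; lra.
(* Multiplying by H - v > 0 turns (v + H) (H - v) into u^2 - K^2 and makes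
   K - u a common factor. *)
have Hv : 0 < H - v by lra.
rewrite -(pmulr_lge0 _ Hv).
have -> : ((K - u) * - u' + (v + H) * v') * (H - v) =
          (K - u) * (- u' * (H - v) - (K + u) * v').
  transitivity ((K - u) * - u' * (H - v) + (H ^+ 2 - v ^+ 2) * v');
    first by ring.
  have -> : H ^+ 2 - v ^+ 2 = u ^+ 2 - K ^+ 2 by lra.
  by ring.
apply: mulr_ge0; first lra.
have a : K * (2 * H) <= - u' * (H - v) by rewrite ler_pM //; lra.
have b : (K + u) * v' <= (2 * K) * H.
  apply: (@le_trans _ _ (2 * K * v')); first by rewrite ler_wpM2r //; lra.
  by rewrite ler_wpM2l //; lra.
lra.
Qed.

Lemma minor_arc_close {R : realFieldType} {K H u v u' v' : R} :
  0 < K -> 0 < H -> u ^+ 2 + v ^+ 2 = K ^+ 2 + H ^+ 2 ->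
  u' ^+ 2 + v' ^+ 2 = K ^+ 2 + H ^+ 2 -> K < u -> K <= u' ->
  K ^+ 2 - H ^+ 2 < u * u' + v * v'.
Proof.
move=> K0 H0 e e' Ku Ku'.
have KK : K * K < u * u'.
  by apply: (lt_le_trans (y := u * K)); rewrite ?ltr_pM2r // ler_pM2l //; lra.
have vH : v ^+ 2 <= H ^+ 2 by nra.
have v'H : v' ^+ 2 <= H ^+ 2 by nra.
suff : - H ^+ 2 <= v * v' by lra.
have := sqr_ge0 (v + v'); lra.
Qed.

(** * A bounded orbit cannot stay on one side *)

(** The recurrence reads u (n + 2) - 2 u (n + 1) + u n = (k - 2) u (n + 1), so
    the increments of u drop by at least (2 - k) m at each step, whereas the
    bounds on u keep them above m - M. *)
Lemma no_bounded_concave_recurrence {R : realType} (u : nat -> R) (k m M : R) :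
  k < 2 -> 0 < m -> (forall n, m < u n <= M) ->
  (forall n, u n.+2 = k * u n.+1 - u n) -> False.
Proof.
move=> k2 m0 uM ur.
have step n : u n.+1 - u n <= u 1%N - u 0%N - n%:R * ((2 - k) * m).
  elim: n => [|n IH]; first by rewrite mul0r subr0.
  rewrite ur -natr1; have /andP[un _] := uM n.+1.
  have : (2 - k) * m <= (2 - k) * u n.+1 by rewrite ler_wpM2l //; lra.
  lra.
have e0 : 0 < (2 - k) * m by rewrite mulr_gt0 //; lra.
set B := (u 1%N - u 0%N + M) / ((2 - k) * m).
have [n Bn] : exists n, B < n%:R.
  by exists (Num.bound `|B|); rewrite (le_lt_trans (ler_norm _)) // archi_boundP.
have /andP[u1 _] := uM n.+1; have /andP[_ u2] := uM n; have := step n.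
move: Bn; rewrite /B ltr_pdivrMr //; lra.
Qed.

(** * Scalar products, lines and segments in the plane *)

Section Vectors.
Context {R : realType}.
Implicit Types (x y z w b p u v : 'rV[R]_2) (r s t : R).

Definition dot u v : R := u 0 0 * v 0 0 + u 0 1 * v 0 1.

Definition det2 u v : R := u 0 0 * v 0 1 - u 0 1 * v 0 0.

Lemma rowvec2P u v : u 0 0 = v 0 0 -> u 0 1 = v 0 1 -> u = v.
Proof.
move=> h0 h1; apply/rowP => i.
by case: i => [[|[|//]]] ltn_i; [move: h0 | move: h1];
  congr (u 0 _ = v 0 _); apply: val_inj.
Qed.

Lemma dotC u v : dot u v = dot v u.
Proof. by rewrite /dot; ring. Qed.

Lemma dotDl u v w : dot (u + v) w = dot u w + dot v w.
Proof. by rewrite /dot !mxE; ring. Qed.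

Lemma dotZl t u v : dot (t *: u) v = t * dot u v.
Proof. by rewrite /dot !mxE; ring. Qed.

Lemma dotNl u v : dot (- u) v = - dot u v.
Proof. by rewrite /dot !mxE; ring. Qed.

Lemma dotDr u v w : dot w (u + v) = dot w u + dot w v.
Proof. by rewrite /dot !mxE; ring. Qed.

Lemma dotZr t u v : dot v (t *: u) = t * dot v u.
Proof. by rewrite /dot !mxE; ring. Qed.

Lemma dotNr u v : dot v (- u) = - dot v u.
Proof. by rewrite /dot !mxE; ring. Qed.

Definition dotE := (dotDl, dotDr, dotZl, dotZr, dotNl, dotNr).

Lemma dot_gt0 {v} : v != 0 -> 0 < dot v v.
Proof.
move=> v0; rewrite lt_neqAle; apply/andP; split; last first.
  by rewrite /dot -!expr2 addr_ge0 ?sqr_ge0.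
apply: contra v0 => /eqP; rewrite /dot => h.
apply/eqP/rowvec2P; rewrite mxE; nra.
Qed.

Lemma dot_sub_gt0 {u v} : u <> v -> 0 < dot u u + dot v v - 2 * dot u v.
Proof.
move=> uv; have -> : dot u u + dot v v - 2 * dot u v = dot (u - v) (u - v).
  by rewrite !dotE (dotC v u); ring.
by apply: dot_gt0; rewrite subr_eq0; apply/eqP.
Qed.

(** Up to the factor <b, b>, the products with b and the determinants against
    b are the coordinates in an orthogonal basis with first vector b; in them
    the tangent at b is a vertical line. *)
Lemma dot_det x y b :
  dot x y * dot b b = dot x b * dot y b + det2 x b * det2 y b.
Proof. by rewrite /dot /det2; ring. Qed.

Lemma circle0P r x : 0 < r -> circle 0 r x <-> dot x x = r ^+ 2.
Proof.
move=> r0; rewrite /circle /= /euclid_norm subr0 big_ord_recl big_ord1.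
have -> : lift ord0 ord0 = 1 :> 'I_2 by apply: val_inj.
have -> : x 0 ord0 ^+ 2 + x 0 1 ^+ 2 = dot x x by rewrite /dot; ring.
split=> [<-|->]; last by rewrite sqrtr_sqr gtr0_norm.
by rewrite sqr_sqrtr // /dot -!expr2 addr_ge0 ?sqr_ge0.
Qed.

Lemma collinearP {x y w} : x <> y ->
  collinear x y w <-> exists t, w = x + t *: (y - x).
Proof.
move=> xy; split=> [[p [v [v0 [[t1 x_] [t2 y_] [t3 w_]]]]]|[t ->]].
  have t12 : t2 - t1 != 0.
    by rewrite subr_eq0; apply/eqP => t12; apply: xy; rewrite x_ y_ t12.
  exists ((t3 - t1) / (t2 - t1)).
  by rewrite x_ y_ w_; apply: rowvec2P; rewrite !mxE; field.
exists x, (y - x); split; first by rewrite subr_eq0; apply/eqP => e; apply: xy.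
split; [exists 0|exists 1|by exists t]; apply: rowvec2P; rewrite !mxE; ring.
Qed.

Lemma collinearC {x y w} : collinear x y w -> collinear y x w.
Proof. by move=> [p [v [v0 [lx ly lw]]]]; exists p, v. Qed.

Lemma segmentC {x y w} : segment x y w -> segment y x w.
Proof.
move=> [l [/andP[l0 l1] ->]]; exists (1 - l).
by rewrite subr_ge0 l1 gerBl l0 subKr addrC.
Qed.

Lemma ray_meets_circle {x v s} : dot x x <= s ^+ 2 -> v != 0 ->
  exists2 t : R, 0 <= t & dot (x + t *: v) (x + t *: v) = s ^+ 2.
Proof.
move=> xs v0; have A0 := dot_gt0 v0.
set D := dot x v ^+ 2 + dot v v * (s ^+ 2 - dot x x).
have D0 : dot x v ^+ 2 <= D by rewrite lerDl mulr_ge0 ?subr_ge0 // ltW.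
exists ((Num.sqrt D - dot x v) / dot v v).
  apply: divr_ge0; last exact: ltW.
  rewrite subr_ge0.
  by rewrite (le_trans (ler_norm _)) // -sqrtr_sqr ler_wsqrtr.
have sq : Num.sqrt D ^+ 2 = D by rewrite sqr_sqrtr // (le_trans _ D0) ?sqr_ge0.
rewrite !dotE (dotC v x).
have A00 : dot v v != 0 by rewrite gt_eqF.
rewrite (_ : _ + _ = dot x x + (Num.sqrt D ^+ 2 - dot x v ^+ 2) / dot v v).
  by rewrite sq /D; field.
by field.
Qed.

Lemma dot_chord x y t :
  dot (x + t *: (y - x)) (x + t *: (y - x)) =
  (1 - t) * dot x x + t * dot y y
  - t * (1 - t) * (dot x x + dot y y - 2 * dot x y).
Proof. by rewrite !dotE (dotC y x); ring. Qed.

Lemma segment_ray {x y z t} : 0 <= t -> t <= 1 -> x = y + t *: (z - y) ->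
  segment y z x.
Proof.
move=> t0 t1 ->; exists (1 - t); split; first by rewrite subr_ge0 t1 gerBl.
by apply: rowvec2P; rewrite !mxE; ring.
Qed.

Lemma collinearD v x y z :
  collinear x y z -> collinear (x + v) (y + v) (z + v).
Proof.
move=> [p [d [d0 [[t1 ->] [t2 ->] [t3 ->]]]]]; exists (p + v), d.
by split=> //; split; [exists t1|exists t2|exists t3]; rewrite addrAC.
Qed.

Lemma collinear_translate v x y z :
  collinear (x + v) (y + v) (z + v) <-> collinear x y z.
Proof.
split; last exact: collinearD.
by move/(collinearD (- v)); rewrite !addrK.
Qed.

Lemma segmentD v x y z :
  segment x y z -> segment (x + v) (y + v) (z + v).
Proof.
move=> [l [l01 ->]]; exists l; split=> //.
by apply: rowvec2P; rewrite !mxE; ring.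
Qed.

Lemma segment_translate v x y z :
  segment (x + v) (y + v) (z + v) <-> segment x y z.
Proof.
split; last exact: segmentD.
by move/(segmentD (- v)); rewrite !addrK.
Qed.

End Vectors.

(** * Notions attached to a pair of concentric circles *)

Section TwoCircles.
Context {R : realType}.
Implicit Types (x y z w b p u v : 'rV[R]_2) (r s t : R).

Definition at_dist t u : Prop := dot u u = t ^+ 2.

Definition on_pair r s u : Prop := at_dist r u \/ at_dist s u.

(** The midpoint of outer points x and y has squared norm (s^2 + <x, y>) / 2,
    and this inequality says that it is in the closed inner disc. For x = y it
    fails, since r < s. *)
Definition far r s x y : Prop := dot x y <= 2 * r ^+ 2 - s ^+ 2.

(** The outer point x is beyond the tangent to the inner circle at b. *)
Definition near r b x : Prop := r ^+ 2 < dot x b.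

(** The points p are the two ends of the chord tangent to the inner circle at
    b; quantifying over them makes the notion visibly invariant under
    isomorphisms. *)
Definition clear r s b x : Prop :=
  forall p, at_dist s p -> dot p b = r ^+ 2 -> ~ far r s x p.

Definition third_points r s x : Prop :=
  forall z, on_pair r s z -> z <> x ->
  exists w, [/\ on_pair r s w, w <> x, w <> z & collinear x z w].

(** The chord tangent to the inner circle is seen from the centre at an angle
    2 a with cos a = r / s; this is cos (2 a). *)
Definition cos_rot r s : R := 2 * r ^+ 2 / s ^+ 2 - 1.

Definition rot r s x : 'rV[R]_2 :=
  let k := cos_rot r s in let l := Num.sqrt (1 - k ^+ 2) in
  \row_i (if i == 0 then k * x 0 0 - l * x 0 1 else l * x 0 0 + k * x 0 1).

End TwoCircles.

(** * Rotation along tangent chords *)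

Section Rotation.
Context {R : realType}.
Context {r s : R} (r0 : 0 < r) (rs : r < s).
Implicit Types (x y z w b p u v : 'rV[R]_2).

Lemma sqr_radii : r ^+ 2 < s ^+ 2.
Proof. by rewrite ltr_pXn2r // nnegrE ltW // (lt_trans r0). Qed.

Let r2 : 0 < r ^+ 2. Proof. by rewrite exprn_gt0. Qed.
Let rs2 := sqr_radii.

Lemma cos_rot_lt1 : `|cos_rot r s| < 1.
Proof.
have s2_gt0 : 0 < s ^+ 2 := lt_trans r2 rs2.
have kE : (cos_rot r s + 1) * s ^+ 2 = 2 * r ^+ 2.
  by rewrite subrK divfK ?gt_eqF.
have k_gt : 0 < cos_rot r s + 1 by rewrite -(pmulr_lgt0 _ s2_gt0) kE mulr_gt0.
have k_lt : cos_rot r s + 1 < 2 by rewrite -(ltr_pM2r s2_gt0) kE ltr_pM2l.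
by rewrite ltr_norml; lra.
Qed.

Lemma rot_props x b : at_dist s x ->
  [/\ at_dist s (rot r s x), dot x (rot r s x) = 2 * r ^+ 2 - s ^+ 2 &
   dot (rot r s (rot r s x)) b = 2 * cos_rot r s * dot (rot r s x) b - dot x b].
Proof.
move=> ox; rewrite /rot; set k := cos_rot r s; set l := Num.sqrt _.
have s2_gt0 : 0 < s ^+ 2 := lt_trans r2 rs2.
have kE : k * s ^+ 2 = 2 * r ^+ 2 - s ^+ 2.
  by rewrite mulrBl divfK ?gt_eqF // mul1r.
have lE : l ^+ 2 = 1 - k ^+ 2.
  have := cos_rot_lt1; rewrite -/k ltr_norml => /andP[k1 k2].
  by rewrite sqr_sqrtr //; nra.
move: ox; rewrite /at_dist /dot !mxE /= => ox; split.
- transitivity ((l ^+ 2 + k ^+ 2) * (x 0 0 * x 0 0 + x 0 1 * x 0 1)).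
    by ring.
  by rewrite ox lE; ring.
- transitivity (k * (x 0 0 * x 0 0 + x 0 1 * x 0 1)); first by ring.
  by rewrite ox kE.
- transitivity (k ^+ 2 * dot x b - l ^+ 2 * dot x b
                + 2 * k * l * (x 0 0 * b 0 1 - x 0 1 * b 0 0)).
    by rewrite /dot; ring.
  by rewrite lE /dot; ring.
Qed.

End Rotation.

(** * Collinearity describes inner points, far pairs and tangents *)

Section Config.
Context {R : realType}.
Context {r s : R} (r0 : 0 < r) (rs : r < s).
Implicit Types (x y z w b p u v : 'rV[R]_2).

Let inn := at_dist r.
Let out := at_dist s.
Let on := on_pair r s.

Let r2 : 0 < r ^+ 2. Proof. by rewrite exprn_gt0. Qed.
Let rs2 : r ^+ 2 < s ^+ 2 := sqr_radii r0 rs.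

Lemma inner_neq_outer {x z} : inn x -> out z -> z <> x.
Proof. by move=> ix oz e; move: rs2; rewrite -ix -e oz ltxx. Qed.

(** Prolonging the segment from z to the inner point x beyond x, one leaves the
    outer disc. *)
Lemma third_point {x z} : inn x -> z <> x ->
  exists w, [/\ out w, w <> x, w <> z & collinear x z w].
Proof.
move=> ix zx.
have v0 : x - z != 0 by rewrite subr_eq0; apply/eqP => e; apply: zx.
have [|t t0 tw] := @ray_meets_circle R x (x - z) s _ v0.
  by rewrite ix ltW.
exists (x + t *: (x - z)); split => //.
- by move=> e; move: tw; rewrite e ix => h; have := rs2; rewrite h ltxx.
- move=> e; have : (1 + t) *: (x - z) = 0.
    by rewrite scalerDl scale1r addrAC e subrr.
  by move/eqP; rewrite scaler_eq0 (negbTE v0) orbF gt_eqF //; lra.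
- apply/collinearP; first exact: nesym.
  by exists (- t); rewrite scaleNr -scalerN opprB.
Qed.

Lemma line_meets_inner {x y} : out x -> out y -> x <> y ->
  (exists2 w, inn w & collinear x y w) <-> far r s x y.
Proof.
move=> ox oy xy; have g0 := dot_sub_gt0 xy; split.
  move=> [w iw /(collinearP xy) [t wE]].
  have := dot_chord x y t; rewrite -wE ox oy iw => h.
  rewrite ox oy in g0.
  (* This is 4 times the squared distance from w to the midpoint of x and y. *)
  have : 0 <= (2 * t - 1) ^+ 2 * (s ^+ 2 + s ^+ 2 - 2 * dot x y).
    by rewrite mulr_ge0 ?sqr_ge0 // ltW.
  rewrite /far; lra.
rewrite /far => h.
have v0 : y - x != 0 by rewrite subr_eq0; apply/eqP => e; apply: xy.
have [|t t0 tw] := @ray_meets_circle R (2^-1 *: (x + y)) (y - x) r _ v0.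
  by rewrite !dotE (dotC y x) ox oy; lra.
exists (2^-1 *: (x + y) + t *: (y - x)) => //.
apply/collinearP => //; exists (2^-1 + t).
by apply: rowvec2P; rewrite !mxE; field.
Qed.

Lemma outer_third {x y w} : out x -> out y -> x <> y -> out w ->
  collinear x y w -> w = x \/ w = y.
Proof.
move=> ox oy xy ow /(collinearP xy) [t wE].
have := dot_chord x y t; rewrite -wE ox oy ow => h.
have /eqP : t * (1 - t) * (s ^+ 2 + s ^+ 2 - 2 * dot x y) = 0 by lra.
have := dot_sub_gt0 xy; rewrite ox oy => g0.
rewrite mulf_eq0 [X in _ || X]gt_eqF // orbF mulf_eq0 => /orP[] /eqP t0.
  by left; rewrite wE t0 scale0r addr0.
by right; rewrite wE (_ : t = 1) ?scale1r ?subrKC //; lra.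
Qed.

(** Such a point is the other end of a chord through x that is tangent to a
    circle of radius strictly between r and s. *)
Lemma outer_close_point {x} : out x ->
  exists z, [/\ out z, z <> x & ~ far r s x z].
Proof.
move=> ox; pose q := (r + s) / 2.
have [rq qs] : r < q /\ q < s by rewrite /q !midf_lt.
have q0 := lt_trans r0 rq.
have q1 := sqr_radii r0 rq; have q2 := sqr_radii q0 qs.
have [oz xz _] := rot_props q0 qs x x ox.
exists (rot q s x); split => //; last by rewrite /far xz; lra.
by move=> e; move: xz; rewrite e ox; lra.
Qed.

Lemma third_pointsP {x} : on x -> inn x <-> third_points r s x.
Proof.
move=> onx; split=> [ix z oz zx|thx].
  by have [w [ow wx wz c]] := third_point ix zx; exists w; split => //; right.
case: onx => // ox.
have [z [oz zx xz]] := outer_close_point ox.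
have [w [[iw|ow] wx wz c]] := thx z (or_intror oz) zx.
  by case: xz; apply/(line_meets_inner ox oz (nesym zx)); exists w.
by case: (outer_third ox oz (nesym zx) ow c).
Qed.

Lemma tangentP {x b} : out x -> inn b ->
  dot x b = r ^+ 2 <-> forall w, inn w -> collinear x b w -> w = b.
Proof.
move=> ox ib; have xb := inner_neq_outer ib ox.
split=> [xbr w iw|wb].
  case/(collinearP xb) => t wE.
  have : dot w w = r ^+ 2 + (1 - t) ^+ 2 * (s ^+ 2 - r ^+ 2).
    by rewrite wE !dotE (dotC b x) ox ib xbr; ring.
  rewrite iw => h.
  have /eqP : (1 - t) ^+ 2 * (s ^+ 2 - r ^+ 2) = 0 by lra.
  rewrite mulf_eq0 [X in _ || X]gt_eqF ?subr_gt0 // orbF sqrf_eq0 => /eqP t1.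
  by rewrite wE (_ : t = 1) ?scale1r ?subrKC //; lra.
have d0 := dot_sub_gt0 xb; set d := _ - _ in d0.
(* The parameter of the second intersection of the line x b with the inner
   circle; it vanishes exactly when the line is tangent. *)
pose t := 2 * (r ^+ 2 - dot x b) / d.
have xb0 : x - b != 0 by rewrite subr_eq0; apply/eqP.
have td : t * d = 2 * (r ^+ 2 - dot x b) by rewrite divfK // gt_eqF.
have : b + t *: (x - b) = b.
  apply: wb.
    transitivity (dot b b + t * (t * d - 2 * (dot b b - dot x b))).
      by rewrite /d !dotE (dotC b x); ring.
    by rewrite td ib; ring.
  by apply/(collinearP xb); exists (1 - t); apply: rowvec2P; rewrite !mxE; ring.
move=> /(canRL (addKr _)); rewrite addNr => /eqP.
rewrite scaler_eq0 (negbTE xb0) orbF => /eqP t0.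
by move: td; rewrite t0; lra.
Qed.

(** * The arcs cut by a tangent chord *)

(** In the coordinates <., b> and det(., b) of an inner point b, the tangent
    chord at b is the segment from (r^2, H) to (r^2, -H). *)
Let H := r * Num.sqrt (s ^+ 2 - r ^+ 2).
Let H0 : 0 < H. Proof. by rewrite mulr_gt0 // sqrtr_gt0 subr_gt0. Qed.
Let HE : H ^+ 2 = r ^+ 2 * (s ^+ 2 - r ^+ 2).
Proof. by rewrite exprMn sqr_sqrtr // subr_ge0 ltW. Qed.

Let KHE : (r ^+ 2) ^+ 2 - H ^+ 2 = (2 * r ^+ 2 - s ^+ 2) * r ^+ 2.
Proof. by rewrite HE; ring. Qed.

Let coords {x b} : out x -> inn b ->
  dot x b ^+ 2 + det2 x b ^+ 2 = (r ^+ 2) ^+ 2 + H ^+ 2.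
Proof. by move=> ox ib; rewrite HE !expr2 -dot_det ox ib; ring. Qed.

Lemma near_clear {x b} : out x -> inn b -> near r b x -> clear r s b x.
Proof.
move=> ox ib xb p op pb; apply/negP; rewrite -ltNge -(ltr_pM2r r2) -KHE.
rewrite -[X in _ < _ * X]ib dot_det.
by apply: (minor_arc_close r2 H0 (coords ox ib) (coords op ib) xb); rewrite pb.
Qed.

Lemma near_not_far {x y b} : out x -> out y -> inn b ->
  near r b x -> near r b y -> ~ far r s x y.
Proof.
move=> ox oy ib xb yb; apply/negP; rewrite -ltNge -(ltr_pM2r r2) -KHE.
rewrite -[X in _ < _ * X]ib dot_det.
exact: (minor_arc_close r2 H0 (coords ox ib) (coords oy ib) xb (ltW yb)).
Qed.

Lemma tangent_point {b} (e : R) : inn b ->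
  e ^+ 2 = r ^+ 2 * (s ^+ 2 - r ^+ 2) ->
  exists p, [/\ out p, dot p b = r ^+ 2 & det2 p b = e].
Proof.
move=> ib eH; pose t := - e / r ^+ 2.
pose p : 'rV[R]_2 :=
  \row_i (if i == 0 then b 0 0 - t * b 0 1 else b 0 1 + t * b 0 0).
have tE : t * r ^+ 2 = - e by rewrite divfK // gt_eqF.
exists p; split; rewrite /out /at_dist /det2 /dot !mxE /=.
- transitivity (dot b b + t ^+ 2 * dot b b); first by rewrite /dot; ring.
  rewrite ib; apply: (mulIf (lt0r_neq0 r2)).
  transitivity ((r ^+ 2) ^+ 2 + (t * r ^+ 2) ^+ 2); first by ring.
  by rewrite tE sqrrN eH; ring.
- by rewrite -ib /dot; ring.
- transitivity (- t * dot b b); first by rewrite /dot; ring.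
  by rewrite ib mulNr tE opprK.
Qed.

Lemma clear_far_near {x y b} : out x -> out y -> inn b -> clear r s b y ->
  ~ near r b y -> far r s x y -> near r b x.
Proof.
move=> ox oy ib yb /negP; rewrite -leNgt => nyb xy.
rewrite /near ltNge; apply/negP => nxb.
have close_tangent e : e ^+ 2 = H ^+ 2 ->
    (r ^+ 2) ^+ 2 - H ^+ 2 < dot y b * r ^+ 2 + det2 y b * e.
  move=> eH; have [p [op pb pe]] := tangent_point e ib (etrans eH HE).
  have /negP := yb p op pb.
  by rewrite -ltNge -(ltr_pM2r r2) -KHE -[X in _ < _ * X]ib dot_det pb pe.
move: xy; apply/negP; rewrite -ltNge -(ltr_pM2r r2) -KHE.
rewrite -[X in _ < _ * X]ib dot_det.
apply: (major_arc_close r2 H0 (coords ox ib) (coords oy ib) nxb nyb).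
  exact: close_tangent.
by rewrite -[- (det2 _ _ * _)]mulrN; apply: close_tangent; rewrite sqrrN.
Qed.

(** Every second term a (2 n) of the sequence a n = <rot^n x, b> satisfies the
    recurrence with coefficient 2 cos (4 a) < 2, where 2 a is the angle of the
    rotation, and a (2 n) > r^2 > 0 would hold for every n. *)
Lemma orbit_leaves_near {x b} : out x -> inn b ->
  ~ (forall n, near r b (iter n.*2 (rot r s) x)).
Proof.
move=> ox ib nr.
have on_orbit n : out (iter n (rot r s) x).
  by elim: n => //= n IH; case: (rot_props r0 rs _ 0 IH).
pose a n := dot (iter n (rot r s) x) b.
have aS n : a n.+2 = 2 * cos_rot r s * a n.+1 - a n.
  by have [] := rot_props r0 rs _ b (on_orbit n).
have k1 := cos_rot_lt1 r0 rs.
apply: (@no_bounded_concave_recurrence R (fun n => a n.*2)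
          ((2 * cos_rot r s) ^+ 2 - 2) (r ^+ 2) ((s ^+ 2 + r ^+ 2) / 2)) => //.
- move: k1; rewrite -(ltr_pXn2r (_ : 0 < 2)%N) ?nnegrE //.
  by rewrite real_normK ?num_real //; lra.
- move=> n; rewrite [_ < _]nr /=.
  have := dot_sub_gt0 (inner_neq_outer ib (on_orbit n.*2)).
  by rewrite on_orbit ib -/(a _); lra.
- move=> n; rewrite !doubleS !aS; ring.
Qed.

(** * Betweenness in terms of nearness *)

Lemma inner_dot_lt {u v} : inn u -> inn v -> u <> v -> dot u v < r ^+ 2.
Proof. by move=> iu iv /dot_sub_gt0; rewrite iu iv; lra. Qed.

(** The tangent at x has y on one side and the inner points other than x on
    the opposite side, so the line y z crosses it between y and z. *)
Lemma near_segment {x y z} : inn x -> inn z -> collinear y z x ->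
  near r x y -> segment y z x.
Proof.
move=> ix iz c xy.
have [->|/eqP zx] := eqVneq x z.
  by apply: (@segment_ray _ _ _ _ 1) => //; rewrite scale1r subrKC.
have zx_lt := inner_dot_lt iz ix (nesym zx).
have yz : y <> z by move=> e; move: xy; rewrite /near e; lra.
have /(collinearP yz) [t xE] := c.
have h : r ^+ 2 = dot y x + t * (dot z x - dot y x).
  by rewrite -ix {1}xE !dotE.
apply: (@segment_ray _ _ _ _ t) => //; move: xy; rewrite /near; nra.
Qed.

Lemma chord_segment {x y z} : inn x -> out y -> out z -> y <> z ->
  collinear y z x -> segment y z x.
Proof.
move=> ix oy oz yz /(collinearP yz) [t xE].
have := dot_chord y z t; rewrite -xE oy oz ix => h.
have := dot_sub_gt0 yz; rewrite oy oz => g0.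
have : 0 < t * (1 - t).
  by rewrite -(pmulr_lgt0 _ g0); have := rs2; lra.
by move=> tt; apply: (@segment_ray _ _ _ _ t) => //; nra.
Qed.

(** For x strictly between y and z, strict convexity of the discs forces x to be
    inner and y, z not to be both inner; if one of them is inner, the other is
    beyond the tangent at x because <x, x> = r^2 is a proper average of <y, x>
    and <z, x>. *)
Lemma segmentP {x y z} : on x -> on y -> on z ->
  segment y z x <->
  [\/ x = y, x = z | [/\ inn x, collinear y z x &
     [\/ [/\ y <> z, out y & out z],
         near r x y /\ inn z | inn y /\ near r x z]]].
Proof.
move=> onx ony onz; split; last first.
  move=> [->|->|[ix c [[yz oy oz]|[xy iz]|[iy xz]]]].
  - by apply: (@segment_ray _ _ _ _ 0); rewrite ?scale0r ?addr0.
  - by apply: (@segment_ray _ _ _ _ 1); rewrite ?scale1r ?subrKC.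
  - exact: chord_segment.
  - exact: near_segment.
  - by apply: segmentC; apply: near_segment => //; apply: collinearC.
move=> [l [/andP[l0 l1] xE]].
have [lz|lz] := eqVneq l 0.
  by constructor 2; rewrite xE lz scale0r add0r subr0 scale1r.
have [lo|lo] := eqVneq l 1.
  by constructor 1; rewrite xE lo scale1r subrr scale0r addr0.
have [yz|/eqP yz] := eqVneq y z.
  by constructor 1; rewrite xE yz -scalerDl subrKC scale1r.
have l0' : 0 < l by rewrite lt_neqAle eq_sym lz.
have l1' : 0 < 1 - l by rewrite subr_gt0 lt_neqAle lo.
have xE' : x = z + l *: (y - z).
  by rewrite xE; apply: rowvec2P; rewrite !mxE; ring.
have xx := dot_chord z y l; rewrite -xE' in xx.
have pos : 0 < l * (1 - l) * (dot z z + dot y y - 2 * dot z y).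
  by rewrite !mulr_gt0 // dot_sub_gt0 //; exact: nesym.
have le_s u : on u -> dot u u <= s ^+ 2 by case=> -> //; exact: ltW rs2.
have ys : l * dot y y <= l * s ^+ 2 by rewrite ler_wpM2l ?le_s.
have zs : (1 - l) * dot z z <= (1 - l) * s ^+ 2.
  by rewrite ler_wpM2l ?le_s // ltW.
have ix : inn x by case: onx => // ox; move: xx; rewrite ox; lra.
have c : collinear y z x.
  by apply/collinearC/(collinearP (nesym yz)); exists l.
have avg : l * dot y x + (1 - l) * dot z x = r ^+ 2.
  transitivity (dot (l *: y + (1 - l) *: z) x); first by rewrite !dotE.
  by rewrite -xE ix.
have xy : y <> x.
  move=> e; have /eqP : (1 - l) *: (y - z) = 0.
    transitivity (y - (z + l *: (y - z))); last by rewrite -xE' e subrr.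
    by apply: rowvec2P; rewrite !mxE; ring.
  rewrite scaler_eq0 gt_eqF //= subr_eq0 => /eqP; exact: yz.
have xz : z <> x.
  move=> e; have /eqP : l *: (y - z) = 0.
    by apply: (addrI z); rewrite -xE' addr0.
  by rewrite scaler_eq0 gt_eqF //= subr_eq0 => /eqP; exact: yz.
constructor 3; split => //.
case: (ony) (onz) => [iy|oy] [iz|oz].
- by move: xx pos; rewrite ix iy iz; lra.
- constructor 3; split=> //; have := inner_dot_lt iy ix xy; rewrite /near; nra.
- constructor 2; split=> //; have := inner_dot_lt iz ix xz; rewrite /near; nra.
- by constructor 1.
Qed.

End Config.

(** * Isomorphisms preserve nearness *)

(** An isomorphism bundled with its inverse, so that the situation is symmetric
    and each preservation lemma is applied to both maps. *)
Record inverse_isos {R : realType} (r s r' s' : R)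
    (f g : 'rV[R]_2 -> 'rV[R]_2) : Prop := InverseIsos {
  src_gt0 : 0 < r;
  src_lt : r < s;
  tgt_gt0 : 0 < r';
  tgt_lt : r' < s';
  iso_on : forall x, on_pair r s x -> on_pair r' s' (f x);
  inv_on : forall y, on_pair r' s' y -> on_pair r s (g y);
  iso_invK : forall x, on_pair r s x -> g (f x) = x;
  inv_isoK : forall y, on_pair r' s' y -> f (g y) = y;
  iso_collinear : forall x y z,
    on_pair r s x -> on_pair r s y -> on_pair r s z ->
    collinear (f x) (f y) (f z) <-> collinear x y z }.

Arguments src_gt0 {R r s r' s' f g} _.
Arguments src_lt {R r s r' s' f g} _.
Arguments tgt_gt0 {R r s r' s' f g} _.
Arguments tgt_lt {R r s r' s' f g} _.
Arguments iso_on {R r s r' s' f g} _ {x} _.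
Arguments iso_invK {R r s r' s' f g} _ {x} _.
Arguments inv_on {R r s r' s' f g} _ {y} _.
Arguments inv_isoK {R r s r' s' f g} _ {y} _.
Arguments iso_collinear {R r s r' s' f g} _ {x y z} _ _ _.

Section Isomorphisms.
Context {R : realType}.
Implicit Types (r s : R) (x y z w b p : 'rV[R]_2) (f g : 'rV[R]_2 -> 'rV[R]_2).

Lemma inverse_isos_sym {r s r' s' f g} :
  inverse_isos r s r' s' f g -> inverse_isos r' s' r s g f.
Proof.
case=> r0 rs r'0 rs' fon gon gf fg col; split=> // x y z onx ony onz.
by rewrite -col ?fg //; apply: gon.
Qed.

Lemma iso_inj {r s r' s' f g x y} : inverse_isos r s r' s' f g ->
  on_pair r s x -> on_pair r s y -> f x = f y -> x = y.
Proof. by move=> I onx ony e; rewrite -(iso_invK I onx) e (iso_invK I). Qed.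

Lemma iso_third_points {r s r' s' f g x} : inverse_isos r s r' s' f g ->
  on_pair r s x -> third_points r s x -> third_points r' s' (f x).
Proof.
move=> I onx thx z onz zx; have ongz := inv_on I onz.
have [|w [onw wx wz c]] := thx (g z) ongz.
  by move=> e; apply: zx; rewrite -e (inv_isoK I).
exists (f w); split; first exact: (iso_on I onw).
- by move=> e; apply: wx; apply: (iso_inj I _ _ e).
- by move=> e; apply: wz; rewrite -e (iso_invK I).
- by rewrite -(inv_isoK I onz); apply/(iso_collinear I).
Qed.

Lemma iso_inner {r s r' s' f g x} : inverse_isos r s r' s' f g ->
  at_dist r x -> at_dist r' (f x).
Proof.
move=> I ix; have onx : on_pair r s x by left.
apply/(third_pointsP (tgt_gt0 I) (tgt_lt I) (iso_on I onx))/(iso_third_points I onx).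
by apply/(third_pointsP (src_gt0 I) (src_lt I) onx).
Qed.

Lemma iso_outer {r s r' s' f g x} : inverse_isos r s r' s' f g ->
  at_dist s x -> at_dist s' (f x).
Proof.
move=> I ox; have onx : on_pair r s x by right.
have [/(iso_inner (inverse_isos_sym I))|//] := iso_on I onx.
rewrite (iso_invK I onx) => ix.
by case: (inner_neq_outer (src_gt0 I) (src_lt I) ix ox).
Qed.

Lemma iso_far {r s r' s' f g x y} : inverse_isos r s r' s' f g ->
  at_dist s x -> at_dist s y -> far r s x y -> far r' s' (f x) (f y).
Proof.
move=> I ox oy xy.
have xNy : x <> y.
  move=> e; move: xy; rewrite /far e oy.
  by have := sqr_radii (src_gt0 I) (src_lt I); lra.
have [w iw c] := (line_meets_inner ox oy xNy).2 xy.
apply/(line_meets_inner (iso_outer I ox) (iso_outer I oy)).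
  by move=> e; apply: xNy; apply: (iso_inj I _ _ e); right.
exists (f w); first exact: (iso_inner I iw).
by apply/(iso_collinear I) => //; [right|right|left].
Qed.

Lemma iso_tangent {r s r' s' f g x b} : inverse_isos r s r' s' f g ->
  at_dist s x -> at_dist r b ->
  dot x b = r ^+ 2 -> dot (f x) (f b) = r' ^+ 2.
Proof.
move=> I ox ib /(tangentP (src_gt0 I) (src_lt I) ox ib) xb.
apply/(tangentP (tgt_gt0 I) (tgt_lt I) (iso_outer I ox) (iso_inner I ib)).
move=> w iw c; have onw : on_pair r' s' w by left.
have igw := iso_inner (inverse_isos_sym I) iw.
rewrite -(inv_isoK I onw) [g w]xb //.
by apply/(iso_collinear I); rewrite ?(inv_isoK I) //; [right|left|left].
Qed.

Lemma iso_clear {r s r' s' f g x b} : inverse_isos r s r' s' f g ->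
  at_dist s x -> at_dist r b -> clear r s b x -> clear r' s' (f b) (f x).
Proof.
move=> I ox ib xb p op pb xp; have J := inverse_isos_sym I.
apply: (xb (g p) (iso_outer J op)).
  by have := iso_tangent J op (iso_inner I ib) pb; rewrite (iso_invK I) //; left.
by have := iso_far J (iso_outer I ox) op xp; rewrite (iso_invK I) //; right.
Qed.

(** The points x1, x2, x3 below are consecutive vertices of a chain of tangent
    chords, hence consecutively far. If x1 is near b and f x1 is not near f b,
    then f x2 is near f b, so it is clear and x2 is clear too; but x2, being
    far from x1, is not near b. This forces x3 to be near b and prevents f x3
    from being near f b, so the disagreement moves on from x1 to x3 for ever. *)
Lemma iso_near {r s r' s' f g x b} : inverse_isos r s r' s' f g ->
  at_dist s x -> at_dist r b -> near r b x -> near r' (f b) (f x).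
Proof.
move=> I ox ib xb; apply: contrapT => nfxb.
have [r0 rs] := (src_gt0 I, src_lt I); have [r'0 rs'] := (tgt_gt0 I, tgt_lt I).
have ifb := iso_inner I ib.
have gclear u : at_dist s u -> clear r' s' (f b) (f u) -> clear r s b u.
  move=> ou /(iso_clear (inverse_isos_sym I) (iso_outer I ou) ifb).
  by rewrite !(iso_invK I) //; [right|left].
suff orbit n : [/\ at_dist s (iter n.*2 (rot r s) x),
    near r b (iter n.*2 (rot r s) x) &
    ~ near r' (f b) (f (iter n.*2 (rot r s) x))].
  by apply: (orbit_leaves_near r0 rs ox ib) => n; case: (orbit n).
elim: n => [//|n [ox1 xb1 nfxb1]].
rewrite doubleS /=; set x1 := iter _ _ _ in ox1 xb1 nfxb1 *.
have [ox2 x12 _] := rot_props r0 rs x1 0 ox1; set x2 := rot r s x1 in ox2 x12 *.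
have [ox3 x23 _] := rot_props r0 rs x2 0 ox2; set x3 := rot r s x2 in ox3 x23 *.
have far12 : far r s x1 x2 by rewrite /far x12.
have far21 : far r s x2 x1 by rewrite /far dotC.
have far23 : far r s x2 x3 by rewrite /far x23.
have far32 : far r s x3 x2 by rewrite /far dotC.
have [ofx1 ofx2] := (iso_outer I ox1, iso_outer I ox2).
have ofx3 := iso_outer I ox3.
have nfx2 : near r' (f b) (f x2).
  have ffar21 := iso_far I ox2 ox1 far21.
  apply: (clear_far_near r'0 rs' ofx2 ofx1 ifb _ nfxb1 ffar21).
  exact: (iso_clear I ox1 ib (near_clear r0 rs ox1 ib xb1)).
have cx2 : clear r s b x2 := gclear x2 ox2 (near_clear r'0 rs' ofx2 ifb nfx2).
have nx2 : ~ near r b x2.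
  by move=> nx2; apply: (near_not_far r0 rs ox1 ox2 ib).
split=> //; first exact: (clear_far_near r0 rs ox3 ox2 ib cx2 nx2 far32).
move=> nfx3; apply: (near_not_far r'0 rs' ofx2 ofx3 ifb nfx2 nfx3).
exact: (iso_far I ox2 ox3 far23).
Qed.

Lemma iso_segment {r s r' s' f g x y z} : inverse_isos r s r' s' f g ->
  on_pair r s x -> on_pair r s y -> on_pair r s z ->
  segment y z x -> segment (f y) (f z) (f x).
Proof.
move=> I onx ony onz.
have [r0 rs] := (src_gt0 I, src_lt I); have [r'0 rs'] := (tgt_gt0 I, tgt_lt I).
move/(segmentP r0 rs onx ony onz) => sxyz.
apply/(segmentP r'0 rs' (iso_on I onx) (iso_on I ony) (iso_on I onz)).
case: sxyz => [->|->|[ix c cases]]; [by constructor 1|by constructor 2|].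
constructor 3; split; [exact: (iso_inner I ix)|exact/(iso_collinear I)|].
have near_outer u : on_pair r s u -> near r x u -> at_dist s u.
  case=> // iu; rewrite /near => xu.
  have [e|/eqP ux] := eqVneq u x; first by move: xu; rewrite e ix ltxx.
  by have := inner_dot_lt iu ix ux; lra.
case: cases => [[yz oy oz]|[xy iz]|[iy xz]].
- constructor 1; split; [|exact: (iso_outer I oy)|exact: (iso_outer I oz)].
  by move=> e; apply: yz; apply: (iso_inj I _ _ e).
- constructor 2; split; last exact: (iso_inner I iz).
  exact: (iso_near I (near_outer _ ony xy) ix xy).
- constructor 3; split; first exact: (iso_inner I iy).
  exact: (iso_near I (near_outer _ onz xz) ix xz).
Qed.

End Isomorphisms.

(** * Reduction to circles centred at the origin *)

Lemma two_circlesP {R : realType} {r s : R} (c x : 'rV[R]_2) : 0 < r -> r < s ->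
  (circle c r `|` circle c s) x <-> on_pair r s (x - c).
Proof.
move=> r0 rs; have s0 := lt_trans r0 rs.
have E t : circle c t x = circle 0 t (x - c) by rewrite /circle /= subr0.
by split=> -[] h; [left|right|left|right]; move: h; rewrite E;
  move/circle0P; apply.
Qed.

Lemma centered_isos {R : realType} {c d : 'rV[R]_2} {r s r' s' : R} {f} :
  0 < r -> r < s -> 0 < r' -> r' < s' ->
  collinearity_iso (circle c r `|` circle c s)
                   (circle d r' `|` circle d s') f ->
  exists g, inverse_isos r s r' s' (fun x => f (x + c) - d) g.
Proof.
move=> r0 rs r'0 rs' [[fto finj fsurj] fcol].
have P := two_circlesP c _ r0 rs; have P' := two_circlesP d _ r'0 rs'.
have onc x : on_pair r s x -> (circle c r `|` circle c s) (x + c).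
  by move=> onx; apply/P; rewrite addrK.
set f0 := fun x : 'rV[R]_2 => f (x + c) - d.
have /choice [g gP] : forall y, exists x,
    on_pair r' s' y -> on_pair r s x /\ f0 x = y.
  move=> y; have [ony|] := pselect (on_pair r' s' y); last by exists 0.
  have [|x onx fx] := fsurj (y + d); first by apply/P'; rewrite addrK.
  by exists (x - c); split; [apply/P | rewrite /f0 subrK fx addrK].
have f0on x : on_pair r s x -> on_pair r' s' (f0 x).
  by move=> onx; apply/P'; apply: fto; apply: onc.
have gon y : on_pair r' s' y -> on_pair r s (g y) by case/gP.
have f0g y : on_pair r' s' y -> f0 (g y) = y by case/gP.
exists g; split=> //.
- move=> x onx; apply: (addIr c); apply: finj; rewrite ?inE.
  + by apply: onc; apply: gon; apply: f0on.
  + exact: onc.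
  + exact: (addIr (- d)) (f0g _ (f0on _ onx)).
- move=> x y z onx ony onz; rewrite collinear_translate fcol; try exact: onc.
  exact: collinear_translate.
Qed.

Theorem lemma5p5 (R : realType) (c d : 'rV[R]_2) (rho rho' tau tau' : R)
    (f : 'rV[R]_2 -> 'rV[R]_2) :
  0 < rho -> rho < rho' -> 0 < tau -> tau < tau' ->
  collinearity_iso (circle c rho `|` circle c rho')
                   (circle d tau `|` circle d tau') f ->
  betweenness_iso (circle c rho `|` circle c rho')
                  (circle d tau `|` circle d tau') f.
Proof.
move=> r0 rs t0 ts fiso; have [fbij _] := fiso; split=> // x y z.
have [g I] := centered_isos r0 rs t0 ts fiso; set f0 := fun x : 'rV[R]_2 => _ in I.
move=> /(two_circlesP _ _ r0 rs) onx /(two_circlesP _ _ r0 rs) ony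
  /(two_circlesP _ _ r0 rs) onz.
rewrite -(segment_translate (- c) y) -(segment_translate (- d) (f y)).
have f0E u : f u - d = f0 (u - c) by rewrite /f0 subrK.
rewrite !f0E; split; last exact: (iso_segment I).
have J := inverse_isos_sym I.
move/(iso_segment J (iso_on I onx) (iso_on I ony) (iso_on I onz)).
by rewrite !(iso_invK I).
Qed.
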